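(* Let $(m_n)_{n\geq 0}$ be a sequence of real numbers with $m_0=1$, let $\mathcal{P}$ be the real linear space of all polynomials in one real variable with real coefficients, and let $\mu:\mathcal{P}\to\mathbb{R}$ be the linear functional defined by $$\mu(P)=\sum_{n\geq 0} x_n m_n \quad\text{for } P(u)=\sum_{n\geq 0}x_n u^n \ \text{(finitely many non-zero coefficients } x_n).$$ Given a non-empty closed subset $S_0$ of $\mathbb{R}$, there exists a probability measure $\rho$ on $\mathbb{R}$, associated to a distribution function $F$, such that (a) $\mathrm{supp}(F)\subset S_0$, and (b) for all $n\geq 0$, $m_n=\int u^n\,d\rho(u)$, if and only if (c) $\mu$ is $S_0$-non-negative, i.e., if $P\in\mathcal{P}$ satisfies $P(u)\geq 0$ for all $u\in S_0$, then $\mu(P)\geq 0$.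
   Context: A distribution function on $\mathbb{R}$ is a right-continuous function $F:\mathbb{R}\to\mathbb{R}$ with $F(b)-F(a)\geq 0$ for all $a\leq b$. The measure associated to $F$ is its Lebesgue-Stieltjes measure $\lambda_F$, characterized by $\lambda_F(]a,b])=F(b)-F(a)$ for $a\leq b$; here $\rho=\lambda_F$. The point spectrum of $F$ is the set of atoms of $\lambda_F$, $ps(F)=\{x\in\mathbb{R}:\ \lambda_F(\{x\})>0\}$, and the support $\mathrm{supp}(F)$ of $F$ is defined as the closure $\overline{ps(F)}$ of the point spectrum.
   Formalization: supp(F) is taken as the topological support of λ_F (points all of whose open neighbourhoods have positive measure), not the closure of the atoms; with the latter the claim fails, e.g. F uniform on [0,1], S_0={5}, P(u)=-(u-5)^2. *)

(* Defs.v *)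
From HB Require Import structures.
From mathcomp Require Import all_boot all_order all_algebra.
From mathcomp Require Import all_classical all_reals all_analysis.

Set Implicit Arguments.
Unset Strict Implicit.
Unset Printing Implicit Defensive.

Import Order.TTheory GRing.Theory Num.Theory.
Import numFieldNormedType.Exports.

Local Open Scope classical_set_scope.
Local Open Scope ring_scope.

(* The support is the set of points all of whose neighbourhoods are charged
   (the points of increase of F), a closed set.  It contains the closure of
   the set of atoms [set x | 0 < lebesgue_stieltjes_measure F [set x]], and
   cannot be replaced by it here: that closure is empty when F is continuous,
   so that its inclusion in S0 does not constrain the measure at all. *)
Definition supp {R : realType} (F : cumulative R R) : set R :=
  [set x | forall U : set R, open U -> U x ->
     (0 < lebesgue_stieltjes_measure F U)%E].

Definition associated {R : realType} (rho : probability (measurableTypeR R) R)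
    (F : cumulative R R) : Prop :=
  forall A : set (measurableTypeR R), measurable A ->
    rho A = lebesgue_stieltjes_measure F A.

Definition has_moments {R : realType}
    (rho : probability (measurableTypeR R) R) (m : nat -> R) : Prop :=
  forall n : nat,
    rho.-integrable [set: measurableTypeR R] (fun u => (u ^+ n)%:E) /\
    (\int[rho]_u (u ^+ n)%:E = (m n)%:E)%E.

Definition moment_functional {R : realType} (m : nat -> R) (P : {poly R}) : R :=
  \sum_(n < size P) P`_n * m n.

Definition nonnegative_on {R : realType} (S0 : set R) (mu : {poly R} -> R) :
    Prop :=
  forall P : {poly R}, (forall u : R, S0 u -> 0 <= P.[u]) -> 0 <= mu P.

(* Main.v *)
(* An S0-positive functional on polynomials extends, by Hahn-Banach, to an
   S0-positive linear functional L on all functions bounded on S0 by a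
   polynomial.  Then G x = L(1_]-oo, x]) is nondecreasing and its right-continuous
   regularization F is a distribution function; F is constant near any point
   outside S0, because indicators vanishing on S0 are killed by L.  Step functions
   whose nodes lie in the dense set where F = G have the same value under L and
   under integration against F, and approximate u^n up to
   (C / N) * (1 + u^2)^(n+1), an error both functionals control once all moments
   of F are known to be finite (Fatou).  Conversely, the complement of the
   support is null, being covered by countably many null rational intervals. *)
Require Import Defs.
From HB Require Import structures.
From mathcomp Require Import all_boot all_order all_algebra.
From mathcomp Require Import all_classical all_reals all_analysis.
From mathcomp Require Import measurable_realfun ring lra.

Set Implicit Arguments.
Unset Strict Implicit.
Unset Printing Implicit Defensive.

Import Order.TTheory GRing.Theory Num.Theory.
Import numFieldNormedType.Exports.

Local Open Scope classical_set_scope.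
Local Open Scope ring_scope.

(** * Hahn-Banach *)

(** Linearity is relative to a predicate [E] on an ambient space, so functionals stay total maps
    with arbitrary values off [E]. *)
Record subspace (R : realType) (V : lmodType R) (E : set V) : Prop := Subspace {
  subspace0 : E 0;
  subspaceD : forall f g, E f -> E g -> E (f + g);
  subspaceZ : forall t f, E f -> E (t *: f) }.

Record sublinear_on (R : realType) (V : lmodType R) (E : set V) (q : V -> R) :
    Prop := Sublinear {
  sublinearD : forall f g, E f -> E g -> q (f + g) <= q f + q g;
  sublinearZ : forall t f, 0 <= t -> E f -> q (t *: f) <= t * q f }.

Section sublinear_theory.
Context {R : realType} {V : lmodType R} {E : set V} (sE : subspace E).
Implicit Types (p q : V -> R) (f g : V).

Lemma subspaceN f : E f -> E (- f).
Proof. by rewrite -scaleN1r; exact: subspaceZ. Qed.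

Lemma sublinear0 q : sublinear_on E q -> q 0 = 0.
Proof.
move=> [qD qZ]; have E0 := subspace0 sE; apply/eqP; rewrite eq_le; apply/andP; split.
  by have := qZ 0 0 (lexx _) E0; rewrite scale0r mul0r.
by have := qD 0 0 E0 E0; rewrite addr0 lerDl.
Qed.

Lemma sublinear_geN q f : sublinear_on E q -> E f -> - q (- f) <= q f.
Proof.
move=> sq Ef; have := sublinearD sq Ef (subspaceN Ef).
by rewrite subrr (sublinear0 sq) -lerBlDr sub0r.
Qed.

(** The reverse inequality is [sublinearZ] for [t^-1] at the vector [t *: f]. *)
Lemma sublinearZE q t f : sublinear_on E q -> 0 <= t -> E f ->
  q (t *: f) = t * q f.
Proof.
move=> sq; rewrite le_eqVlt => /predU1P[<-|t0] Ef.
  by rewrite scale0r mul0r (sublinear0 sq).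
apply/eqP; rewrite eq_le (sublinearZ sq (ltW t0))//= mulrC -ler_pdivlMr// mulrC.
have t1 : 0 <= t^-1 by rewrite invr_ge0 ltW.
have := sublinearZ sq t1 (subspaceZ sE t Ef).
by rewrite scalerA mulVf ?gt_eqF// scale1r.
Qed.

(** Supplies bounds of chains for Zorn's lemma. Comparability keeps the infimum subadditive: the
    smaller of [q1] and [q2] serves both summands. *)
Lemma sublinear_inf (p : V -> R) (A : set (V -> R)) : A !=set0 ->
  (forall q, A q -> sublinear_on E q /\ forall f, E f -> q f <= p f) ->
  (forall q1 q2, A q1 -> A q2 ->
     (forall f, E f -> q1 f <= q2 f) \/ (forall f, E f -> q2 f <= q1 f)) ->
  [/\ sublinear_on E (fun f => inf [set q f | q in A]),
      (forall f, E f -> inf [set q f | q in A] <= p f) &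
      forall q f, A q -> E f -> inf [set q f | q in A] <= q f].
Proof.
move=> [q0 Aq0] Ap tot.
have lbd f : E f -> has_inf [set q f | q in A].
  move=> Ef; split; first by exists (q0 f), q0.
  (* Uniform in [q], because [- p (- f) <= - q (- f) <= q f]. *)
  exists (- p (- f)) => _ [q Aq <-]; have [sq qp] := Ap _ Aq.
  by rewrite (le_trans _ (sublinear_geN sq Ef))// lerN2 qp//; exact: subspaceN.
have infle q f : A q -> E f -> inf [set q f | q in A] <= q f.
  by move=> Aq Ef; apply: ge_inf; [exact: (lbd f Ef).2|exists q].
split=> //; last first.
  by move=> f Ef; rewrite (le_trans (infle _ _ Aq0 Ef))// (Ap _ Aq0).2.
split=> [f g Ef Eg|t f t0 Ef].
  have Efg := subspaceD sE Ef Eg.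
  rewrite -lerBlDr; apply: lb_le_inf; first exact: (lbd f Ef).1.
  move=> _ [q1 Aq1 <-]; rewrite lerBlDr -lerBlDl.
  apply: lb_le_inf; first exact: (lbd g Eg).1.
  move=> _ [q2 Aq2 <-]; rewrite lerBlDl.
  have [q12|q21] := tot _ _ Aq1 Aq2.
    rewrite (le_trans (infle _ _ Aq1 Efg))//.
    by rewrite (le_trans (sublinearD (Ap _ Aq1).1 Ef Eg))// lerD2l q12.
  rewrite (le_trans (infle _ _ Aq2 Efg))//.
  by rewrite (le_trans (sublinearD (Ap _ Aq2).1 Ef Eg))// lerD2r q21.
have Etf := subspaceZ sE t Ef.
move: t0; rewrite le_eqVlt => /predU1P[t0|t0].
  rewrite -t0 mul0r scale0r (le_trans (infle _ _ Aq0 (subspace0 sE)))//.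
  by rewrite (sublinear0 (Ap _ Aq0).1).
rewrite mulrC -ler_pdivrMr//; apply: lb_le_inf; first exact: (lbd f Ef).1.
move=> _ [q Aq <-]; rewrite ler_pdivrMr// mulrC (le_trans (infle _ _ Aq Etf))//.
by rewrite (sublinearZE (Ap _ Aq).1)// ltW.
Qed.

(** [q'] is the infimum of [q (f + t *: g) - t * q g] over [t >= 0]: [t = 0] gives the first bound,
    [t = 1] the second. When [q] is minimal, the second bound becomes superadditivity. *)
Lemma sublinear_shift q g : sublinear_on E q -> E g ->
  exists q', [/\ sublinear_on E q', forall f, E f -> q' f <= q f &
    forall f, E f -> q' f <= q (f + g) - q g].
Proof.
move=> sq Eg.
pose S f := [set q (f + t *: g) - t * q g | t in [set t | 0 <= t]].
have Ef' f t : E f -> E (f + t *: g).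
  by move=> Ef; apply: (subspaceD sE) => //; exact: (subspaceZ sE).
have hS f : E f -> has_inf (S f).
  move=> Ef; split; first by exists (q (f + 0 *: g) - 0 * q g), 0 => /=.
  exists (- q (- f)) => _ [t /= t0 <-].
  rewrite lerBrDr addrC lerBlDr -(sublinearZE sq)//.
  have := sublinearD sq (Ef' f t Ef) (subspaceN Ef).
  by rewrite addrAC subrr add0r.
have Sle f t : E f -> 0 <= t -> inf (S f) <= q (f + t *: g) - t * q g.
  by move=> Ef t0; apply: ge_inf; [exact: (hS f Ef).2|exists t].
exists (fun f => inf (S f)); split.
- split=> [f1 f2 Ef1 Ef2|t f t0 Ef].
    rewrite -lerBlDr; apply: lb_le_inf; first exact: (hS f1 Ef1).1.
    move=> _ [t1 /= t10 <-]; rewrite lerBlDr -lerBlDl.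
    apply: lb_le_inf; first exact: (hS f2 Ef2).1.
    move=> _ [t2 /= t20 <-]; rewrite lerBlDl.
    rewrite (le_trans (Sle _ (t1 + t2) (subspaceD sE Ef1 Ef2) (addr_ge0 _ _)))//.
    rewrite scalerDl addrACA mulrDl opprD [leRHS]addrACA lerD2r.
    exact: sublinearD (Ef' _ _ _) (Ef' _ _ _).
  move: t0; rewrite le_eqVlt => /predU1P[<-|t0].
    rewrite mul0r scale0r (le_trans (Sle _ 0 (subspace0 sE) _))//.
    by rewrite scale0r addr0 mul0r subr0 (sublinear0 sq).
  rewrite mulrC -ler_pdivrMr//; apply: lb_le_inf; first exact: (hS f Ef).1.
  move=> _ [s /= s0 <-]; rewrite ler_pdivrMr// mulrC.
  have ts0 : 0 <= t * s by rewrite mulr_ge0// ltW.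
  rewrite (le_trans (Sle _ _ (subspaceZ sE t Ef) ts0))//.
  rewrite mulrBr mulrA lerD2r -scalerA -scalerDr (sublinearZE sq)//.
  - exact: ltW.
  - exact: Ef'.
- move=> f Ef; rewrite (le_trans (Sle _ 0 Ef _))//.
  by rewrite scale0r addr0 mul0r subr0.
- by move=> f Ef; rewrite (le_trans (Sle _ 1 Ef _))// scale1r mul1r.
Qed.

(* A sublinear functional which is minimal among those below [p] is linear. *)
Theorem hahn_banach p : sublinear_on E p ->
  exists L : V -> R, [/\ {in E &, {morph L : f g / f + g}},
    (forall t, {in E, {morph L : f / t *: f >-> t * f}}) &
    forall f, E f -> L f <= p f].
Proof.
move=> sp.
pose Q (q : V -> R) := sublinear_on E q /\ forall f, E f -> q f <= p f.
pose T := {q : V -> R | Q q}.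
have p0 : T by exists p; split.
(* The order is reversed, so a maximal element is a minimal functional. *)
pose le (q1 q2 : T) := `[< forall f, E f -> sval q2 f <= sval q1 f >].
have [|r s t|A totA|q qmin] := @ZL_preorder T p0 le.
- by move=> t; apply/asboolP.
- move=> /asboolP rs /asboolP st; apply/asboolP => f Ef.
  exact: le_trans (st _ Ef) (rs _ Ef).
- have [[q0 Aq0]|A0] := pselect (A !=set0); last first.
    by exists p0 => s As; absurd False => //; apply: A0; exists s.
  have [|||slin infp infq] := @sublinear_inf p [set sval q | q in A].
  + by exists (sval q0), q0.
  + by move=> _ [q Aq <-]; exact: svalP q.
  + move=> _ _ [q1 Aq1 <-] [q2 Aq2 <-].
    by have [/asboolP|/asboolP] := totA _ _ Aq1 Aq2; [right|left].
  exists (exist Q _ (conj slin infp)) => q Aq; apply/asboolP => f Ef /=.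
  by apply: infq => //; exists q.
case: q qmin => q [sq qp] qmin.
have qD f g : E f -> E g -> q (f + g) = q f + q g.
  move=> Ef Eg; apply/eqP; rewrite eq_le (sublinearD sq)//=.
  (* Minimality turns [q' <= q] into [q <= q'], hence [q f <= q (f + g) - q g]. *)
  have [q' [sq' q'q q'g]] := sublinear_shift sq Eg.
  have q'p h : E h -> q' h <= p h.
    by move=> Eh; exact: le_trans (q'q _ Eh) (qp _ Eh).
  have /asboolP/= qq' := qmin (exist Q q' (conj sq' q'p)) (asboolT q'q).
  by rewrite -lerBrDr (le_trans (qq' f Ef)) ?q'g.
have qN f : E f -> q (- f) = - q f.
  move=> Ef; apply/eqP; rewrite -addr_eq0 -qD//; last exact: subspaceN.
  by rewrite addNr (sublinear0 sq).
exists q; split=> //.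
  by move=> f g; rewrite !inE; exact: qD.
move=> t f; rewrite inE => Ef; have [t0|t0] := leP 0 t.
  exact: (sublinearZE sq).
have Et := subspaceZ sE (- t) Ef.
rewrite -[t in LHS]opprK scaleNr qN// (sublinearZE sq)//.
  by rewrite mulNr opprK.
by rewrite oppr_ge0 ltW.
Qed.

End sublinear_theory.

(** * Extension of the moment functional *)

Lemma moment_functional_widen (R : realType) (m : nat -> R) (P : {poly R}) N :
  (size P <= N)%N -> moment_functional m P = \sum_(n < N) P`_n * m n.
Proof.
move=> PN; rewrite /moment_functional (big_ord_widen N (fun n => P`_n * m n) PN).
rewrite big_mkcond; apply: eq_bigr => i _; case: ltnP => // Pi.
by rewrite nth_default// mul0r.
Qed.

Lemma moment_functionalD (R : realType) (m : nat -> R) (P Q : {poly R}) :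
  moment_functional m (P + Q) = moment_functional m P + moment_functional m Q.
Proof.
pose N := maxn (size P) (size Q).
rewrite (@moment_functional_widen _ _ _ N) ?size_polyD//.
rewrite (@moment_functional_widen _ _ P N) ?leq_maxl//.
rewrite (@moment_functional_widen _ _ Q N) ?leq_maxr// -big_split/=.
by apply: eq_bigr => i _; rewrite coefD mulrDl.
Qed.

Lemma moment_functionalZ (R : realType) (m : nat -> R) t (P : {poly R}) :
  moment_functional m (t *: P) = t * moment_functional m P.
Proof.
rewrite (@moment_functional_widen _ _ _ (size P)) ?size_scale_leq//.
by rewrite mulr_sumr; apply: eq_bigr => i _; rewrite coefZ mulrA.
Qed.

Lemma moment_functionalXn (R : realType) (m : nat -> R) n :
  moment_functional m 'X^n = m n.
Proof.
rewrite /moment_functional size_polyXn big_ord_recr/= coefXn eqxx mul1r.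
rewrite big1 ?add0r// => i _.
by rewrite coefXn (ltn_eqF (ltn_ord i)) mul0r.
Qed.

(** The domain of the extended functional; it contains the polynomials and all indicators. The bound
    is asked on [S0] only, so every function vanishing on [S0] belongs to it too. *)
Definition poly_bounded (R : realType) (S0 : set R) : set (R -> R) :=
  [set f | exists P : {poly R}, forall u, S0 u -> `|f u| <= P.[u]].

Lemma poly_bounded_subspace (R : realType) (S0 : set R) :
  subspace (poly_bounded S0).
Proof.
split.
- by exists 0 => u _; rewrite hornerE normr0.
- move=> f g [P fP] [Q gQ]; exists (P + Q) => u Su.
  by rewrite hornerE (le_trans (ler_normD _ _))// lerD ?fP ?gQ.
- move=> t f [P fP]; exists (`|t| *: P) => u Su.
  by rewrite hornerE normrM ler_wpM2l ?fP.
Qed.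

Lemma poly_bounded_horner (R : realType) (S0 : set R) (P : {poly R}) :
  poly_bounded S0 (horner P).
Proof.
exists (P ^+ 2 + 1) => u _; rewrite !hornerE ler_norml.
by apply/andP; split; nra.
Qed.

(* Hahn-Banach applied to [f |-> inf {mu P | P >= f on S0}]. *)
Theorem riesz_extension (R : realType) (m : nat -> R) (S0 : set R) :
  nonnegative_on S0 (moment_functional m) ->
  exists L : (R -> R) -> R, [/\
    {in poly_bounded S0 &, {morph L : f g / f + g}},
    forall t, {in poly_bounded S0, {morph L : f / t *: f >-> t * f}},
    forall f, poly_bounded S0 f -> (forall u, S0 u -> 0 <= f u) -> 0 <= L f &
    forall P : {poly R}, L (horner P) = moment_functional m P].
Proof.
move=> mu_ge0; set mu := moment_functional m in mu_ge0 *; set E := poly_bounded S0.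
have sE : subspace E := poly_bounded_subspace S0.
pose A f : set R := [set mu P | P in [set P | forall u, S0 u -> f u <= P.[u]]].
pose p f := inf (A f).
(* If [- Q <= f <= P] on [S0], then [P + Q] is non-negative there and [- mu Q <= mu P]: the infimum
   is finite. *)
have hA f : E f -> has_inf (A f).
  move=> [Q fQ]; split.
    by exists (mu Q), Q => //= u Su; rewrite (le_trans (ler_norm _)) ?fQ.
  exists (- mu Q) => _ [P/= fP <-].
  rewrite -subr_ge0 opprK -moment_functionalD; apply: mu_ge0 => u Su.
  rewrite hornerE; have := fQ _ Su; have := fP _ Su.
  by rewrite ler_norml => ? /andP[? ?]; lra.
have ple f P : E f -> (forall u, S0 u -> f u <= P.[u]) -> p f <= mu P.
  by move=> Ef fP; apply: ge_inf; [exact: (hA f Ef).2|exists P].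
have sp : sublinear_on E p.
  split=> [f g Ef Eg|t f t0 Ef].
    rewrite -lerBlDr; apply: lb_le_inf; first exact: (hA f Ef).1.
    move=> _ [P/= fP <-]; rewrite lerBlDr -lerBlDl.
    apply: lb_le_inf; first exact: (hA g Eg).1.
    move=> _ [Q/= gQ <-]; rewrite lerBlDl -moment_functionalD.
    apply: ple; first exact: subspaceD.
    by move=> u Su; rewrite hornerE lerD ?fP ?gQ.
  have Etf := subspaceZ sE t Ef.
  move: t0; rewrite le_eqVlt => /predU1P[t0|t0].
    rewrite -t0 mul0r scale0r.
    have -> : 0 = mu 0 by rewrite /mu /moment_functional size_poly0 big_ord0.
    apply: ple; first exact: subspace0.
    by move=> u _; rewrite hornerE.
  rewrite mulrC -ler_pdivrMr//; apply: lb_le_inf; first exact: (hA f Ef).1.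
  move=> _ [P/= fP <-]; rewrite ler_pdivrMr// mulrC -moment_functionalZ.
  apply: ple => // u Su; rewrite hornerE.
  by rewrite ler_wpM2l ?fP// ltW.
have [L [LD LZ Lp]] := hahn_banach sE sp.
have LN f : E f -> L (- f) = - L f.
  by move=> Ef; rewrite -scaleN1r LZ ?mulN1r// inE.
exists L; split=> //.
(* The zero polynomial majorizes [- f] on [S0], so [L (- f) <= p (- f) <= 0]. *)
- move=> f Ef f0; rewrite -oppr_le0 -LN//.
  have ENf := subspaceN sE Ef.
  rewrite (le_trans (Lp _ ENf))//.
  have -> : 0 = mu 0 by rewrite /mu /moment_functional size_poly0 big_ord0.
  by apply: ple => // u Su; rewrite hornerE oppr_le0 f0.
(* [P] majorizes itself, which gives one inequality; the same for [- P] gives the other. *)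
- have Lmu P : L (horner P) <= mu P.
    have EP := poly_bounded_horner S0 P.
    by rewrite (le_trans (Lp _ EP))// ple.
  move=> P; apply/eqP; rewrite eq_le Lmu/=.
  have EP := poly_bounded_horner S0 P.
  have := Lmu (- P).
  have -> : horner (- P) = - horner P by apply/funext => u; rewrite hornerE.
  by rewrite LN// -(scaleN1r P) /mu moment_functionalZ mulN1r lerN2.
Qed.

(** * Regularization of nondecreasing functions *)

Lemma lebesgue_stieltjes_ocitv (R : realType) (F : cumulative R R) (a b : R) :
  a <= b -> lebesgue_stieltjes_measure F `]a, b]%classic = (F b - F a)%:E.
Proof.
move=> ab; rewrite /lebesgue_stieltjes_measure /measure_extension.
by rewrite measurable_mu_extE/= ?wlength_itv_bnd//; exact: is_ocitv.
Qed.

(** [F x] is the right limit of [G] at [x], written as the infimum of [G] over []x, +oo[]. *)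
Lemma right_regularization (R : realType) (G : R -> R) :
  nondecreasing G -> G @ -oo --> (0 : R) -> G @ +oo --> (1 : R) ->
  exists F : cumulativeBounded (0 : R) (1 : R),
    (forall x, G x <= F x) /\ forall x y, x < y -> F x <= G y.
Proof.
move=> ndG GNy Gy.
pose S x := G @` `]x, +oo[%classic.
pose F x := inf (S x).
have S0 x : S x !=set0.
  by exists (G (x + 1)), (x + 1); rewrite //= in_itv/= ltrDl ltr01.
have Slb x : lbound (S x) (G x).
  by move=> _ [y/= /[!in_itv]/= /[!andbT] xy <-]; exact/ndG/ltW.
have GF x : G x <= F x by apply: lb_le_inf; [exact: S0|exact: Slb].
have FG x y : x < y -> F x <= G y.
  move=> xy; apply: ge_inf; first by exists (G x); exact: Slb.
  by exists y => //=; rewrite in_itv/= andbT.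
have ndF : nondecreasing F.
  move=> x y; rewrite le_eqVlt => /predU1P[->//|xy].
  exact: le_trans (FG _ _ xy) (GF y).
have rcF : right_continuous F.
  move=> x; apply/cvgrPdist_le => e e0.
  have [_ [y/= /[!in_itv]/= /[!andbT] xy <-] Gye] :=
    inf_adherent e0 (conj (S0 x) (ex_intro _ _ (Slb x))).
  near=> z.
  have xz : x < z by near: z; exact: nbhs_right_gt.
  have zy : z < y by near: z; exact: nbhs_right_lt.
  have := ndF _ _ (ltW xz); have := FG _ _ zy; move: Gye; rewrite -/(F x).
  by rewrite ler_norml => ? ? ?; apply/andP; split; lra.
have FNy : F @ -oo --> (0 : R).
  apply/cvgrPdist_le => e e0.
  have /cvgrPdist_le/(_ _ e0)[M [_ HM]] := GNy.
  (* The shift by one makes room for [F x <= G (x + 1)]. *)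
  exists (M - 1); split; first exact: num_real.
  move=> x xM; have xM' : x < M by lra.
  have x1M : x + 1 < M by lra.
  have x1 : x < x + 1 by lra.
  have := HM _ xM'; have := HM _ x1M => /=.
  have := FG _ _ x1; have := GF x.
  rewrite !ler_norml => ? ? /andP[? ?] /andP[? ?].
  by apply/andP; split; lra.
have Fy : F @ +oo --> (1 : R).
  apply/cvgrPdist_le => e e0.
  have /cvgrPdist_le/(_ _ e0)[M [_ HM]] := Gy.
  exists M; split; first exact: num_real.
  move=> x xM.
  have x1M : M < x + 1 by lra.
  have x1 : x < x + 1 by lra.
  have := HM _ xM; have := HM _ x1M => /=.
  have := FG _ _ x1; have := GF x.
  rewrite !ler_norml => ? ? /andP[? ?] /andP[? ?].
  by apply/andP; split; lra.
pose F' : cumulativeBounded (0 : R) (1 : R) := HB.pack F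
  (isCumulative.Build R _ R F ndF rcF)
  (isCumulativeBounded.Build R 0 1 F FNy Fy).
by exists F'.
Unshelve. all: by end_near. Qed.

(* The open intervals [`]G x, F x[] are pairwise disjoint. *)
Lemma regularization_eq_dense (R : realType) (G F : R -> R) (a b : R) :
  (forall x, G x <= F x) -> (forall x y, x < y -> F x <= G y) -> a < b ->
  exists x, a < x < b /\ F x = G x.
Proof.
move=> GF FG ab; apply: contrapT => nex.
pose I := {x | x \in `]a, b[%classic}.
have FGlt (i : I) : G (sval i) < F (sval i).
  rewrite lt_neqAle GF andbT; apply/eqP => GFi; apply: nex.
  exists (sval i); split=> //; have := svalP i.
  by rewrite inE/= in_itv.
(* Points without a jump get an arbitrary non-empty open interval, since [B] must be total. *)
pose B x := if G x < F x then `]G x, F x[%classic else `]0, 1[%classic : set R.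
have cnt : countable `]a, b[%classic.
  apply: (@separated_open_countable _ _ B).
  - by move=> x; rewrite /B; case: ifP => _; exact: interval_open.
  - move=> x; rewrite /B; case: ifP => h.
      by exists ((G x + F x) / 2); rewrite /= in_itv/= !midf_lt.
    by exists (1 / 2) => /=; rewrite in_itv/=; apply/andP; split; lra.
  - have key x y : `]a, b[%classic x -> `]a, b[%classic y -> x < y ->
        ~ (B x `&` B y !=set0).
      move=> /mem_set xab /mem_set yab xy [z []].
      rewrite /B (FGlt (exist _ x xab)) (FGlt (exist _ y yab))/= !in_itv/=.
      by have := FG _ _ xy => ? /andP[_ ?] /andP[? _]; lra.
    move=> x y xab yab xy.
    have [lt|gt|//] := ltgtP x y; first by have := key _ _ xab yab lt xy.
    by rewrite setIC in xy; have := key _ _ yab xab gt xy.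
(* A countable interval is Lebesgue-null, against its length [b - a > 0]. *)
have := countable_lebesgue_measure0 cnt.
rewrite lebesgue_measure_itv/= lte_fin ab -EFinD => -[] /eqP.
by rewrite subr_eq0 => /eqP ba; move: ab; rewrite ba ltxx.
Qed.

(** * Approximation of powers by step functions *)

(** Cells are open on the left and closed on the right, so that a Lebesgue-Stieltjes measure gives
    them mass [F (x i.+1) - F (x i)]. *)
Definition step_fun (R : realType) (x : nat -> R) K (phi : R -> R) (u : R) : R :=
  \sum_(i < K) phi (x i.+1) * \1_(`]x i, x i.+1]%classic) u.

(** Monotone nodes make the cells disjoint, so at most one term survives. *)
Lemma step_funP (R : realType) (x : nat -> R) K (phi : R -> R) u :
  (forall i, x i <= x i.+1) ->
  (exists2 i, x i < u <= x i.+1 & step_fun x K phi u = phi (x i.+1)) \/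
  ((u <= x 0%N \/ x K < u) /\ step_fun x K phi u = 0).
Proof.
move=> xS; have ndx : {homo x : i j / (i <= j)%N >-> i <= j}.
  exact/nondecreasing_seqP.
rewrite /step_fun; elim: K => [|K IHK].
  by right; rewrite big_ord0; split=> //; have [|] := leP u (x 0%N); [left|right].
rewrite big_ord_recr/= indicE; have [uK|uK] := boolP (u \in `]x K, x K.+1]%classic).
  left; exists K; first by move: uK; rewrite inE/= in_itv.
  rewrite mulr1 big1 ?add0r// => i _; rewrite indicE memNset ?mulr0//=.
  move: uK; rewrite inE/= !in_itv/= => /andP[xKu _] /andP[_ uxi].
  by have := lt_le_trans xKu (le_trans uxi (ndx _ _ (ltn_ord i))); rewrite ltxx.
rewrite mulr0 addr0; case: IHK => [[i iu ->]|[ux ->]]; first by left; exists i.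
right; split=> //; case: ux => [|xKu]; first by left.
right; rewrite ltNge; apply: contra uK => uK1; rewrite inE/= in_itv/=.
by rewrite xKu.
Qed.

(** Transfers a bound at a node [v] to a nearby point [u]. The constant comes from
    [v ^+ 2 <= 2 * u ^+ 2 + 8]. *)
Lemma weight_shift (R : realType) (u v : R) : `|u - v| <= 2 ->
  1 + v ^+ 2 <= 9 * (1 + u ^+ 2).
Proof.
rewrite ler_norml => /andP[? ?].
have h : (u - v) ^+ 2 <= 4 by nra.
have := sqr_ge0 (2 * u - v); nra.
Qed.

Lemma pow_le_weight (R : realType) (u v : R) n : `|u - v| <= 2 ->
  `|v ^+ n| <= 9 ^+ n * (1 + u ^+ 2) ^+ n.
Proof.
move=> uv; rewrite normrX -exprMn lerXn2r ?nnegrE//.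
  by rewrite mulr_ge0// addr_ge0// sqr_ge0.
rewrite (le_trans _ (weight_shift uv))// ler_norml.
by apply/andP; split; nra.
Qed.

(** Induction through [u * (u ^+ n - v ^+ n) + (u - v) * v ^+ n]; the new factor [9 * (1 + u ^+ 2)]
    dominates both [|u|] and [1]. *)
Lemma pow_lipschitz (R : realType) (u v : R) n : `|u - v| <= 2 ->
  `|u ^+ n - v ^+ n| <= n%:R * `|u - v| * (9 ^+ n * (1 + u ^+ 2) ^+ n).
Proof.
move=> uv; elim: n => [|n IHn]; first by rewrite !expr0 subrr normr0 !mul0r.
set W := 9 ^+ n * (1 + u ^+ 2) ^+ n in IHn *.
have W0 : 0 <= W by rewrite mulr_ge0// exprn_ge0// addr_ge0// sqr_ge0.
have -> : 9 ^+ n.+1 * (1 + u ^+ 2) ^+ n.+1 = 9 * (1 + u ^+ 2) * W.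
  by rewrite /W !exprS; ring.
have -> : u ^+ n.+1 - v ^+ n.+1 = u * (u ^+ n - v ^+ n) + (u - v) * v ^+ n.
  by rewrite !exprS; ring.
rewrite (le_trans (ler_normD _ _))// !normrM.
have u1 : `|u| <= 9 * (1 + u ^+ 2) by rewrite ler_norml; apply/andP; split; nra.
have t1 : `|u| * `|u ^+ n - v ^+ n| <=
    9 * (1 + u ^+ 2) * (n%:R * `|u - v| * W) by rewrite ler_pM.
have t2 : `|u - v| * `|v ^+ n| <= `|u - v| * (9 * (1 + u ^+ 2) * W).
  rewrite ler_wpM2l// (le_trans (pow_le_weight n uv))//.
  by rewrite -[leLHS]mul1r ler_wpM2r//; nra.
rewrite (le_trans (lerD t1 t2))// -natr1.
by rewrite le_eqVlt; apply/orP; left; apply/eqP; ring.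
Qed.

(** The extra weight factor pays for the decay: [1 + u ^+ 2 >= 1 + j ^+ 2 >= (j + 1) / 2]. *)
Lemma pow_tail (R : realType) (u j : R) n : 0 <= j -> j <= `|u| ->
  `|u ^+ n| <= 2 / (j + 1) * (1 + u ^+ 2) ^+ n.+1.
Proof.
move=> j0 ju.
have w0 : 0 <= (1 + u ^+ 2) ^+ n by rewrite exprn_ge0// addr_ge0// sqr_ge0.
have un : `|u ^+ n| <= (1 + u ^+ 2) ^+ n.
  rewrite normrX lerXn2r ?nnegrE// ?addr_ge0 ?sqr_ge0//.
  by rewrite ler_norml; apply/andP; split; nra.
have j2 : j ^+ 2 <= u ^+ 2.
  by rewrite -[u ^+ 2]real_normK ?num_real// ler_pXn2r ?nnegrE.
rewrite (le_trans un)// [_ ^+ n.+1]exprS mulrA -[leLHS]mul1r ler_wpM2r//.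
rewrite mulrAC ler_pdivlMr ?mul1r; last by lra.
have := sqr_ge0 (j - 1); nra.
Qed.

(** One point of [D] is chosen in each cell of a uniform grid of mesh [h = 1 / (N + 1)], so
    consecutive choices are at most [2 * h] apart. *)
Lemma grid_dense (R : realType) (D : set R) (N : nat) :
  (forall a b, a < b -> exists x, a < x < b /\ D x) ->
  exists (x : nat -> R) K, [/\ forall i, D (x i),
    forall i, x i <= x i.+1 <= x i + 2 / (N%:R + 1),
    x 0%N <= - N%:R & N%:R <= x K].
Proof.
move=> dD; pose h : R := 1 / (N%:R + 1).
have N1 : 0 < N%:R + 1 :> R by rewrite ltr_pwDr.
have h0 : 0 < h by rewrite divr_gt0.
have h1 : h <= 1 by rewrite ler_pdivrMr// mul1r lerDr.
pose a (i : nat) : R := i%:R * h - (N%:R + 1).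
have aS i : a i.+1 = a i + h by rewrite /a -natr1; ring.
have /choice[x xP] i : exists x, a i < x < a i.+1 /\ D x.
  by apply: dD; rewrite aS ltrDl.
(* This many cells of mesh [h] lead from [- (N + 1)] to [N + 1]. *)
exists x, (2 * N.+1 ^ 2)%N; split.
- by move=> i; have [] := xP i.
- move=> i; have [/andP[? ?] _] := xP i; have [/andP[? ?] _] := xP i.+1.
  have -> : 2 / (N%:R + 1) = h + h :> R by rewrite /h; field; rewrite gt_eqF.
  have := aS i; have := aS i.+1; clearbody a h => ? ?.
  by apply/andP; split; lra.
- have [/andP[_ ?] _] := xP 0%N; have := aS 0%N.
  have : a 0%N = - (N%:R + 1) by rewrite /a mul0r add0r.
  clearbody a h => ? ?; lra.
- have [/andP[? _] _] := xP (2 * N.+1 ^ 2)%N.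
  have : a (2 * N.+1 ^ 2)%N = N%:R + 1.
    by rewrite /a natrM natrX -natr1 /h; field; rewrite gt_eqF.
  lra.
Qed.

(** The first bound is uniform in [N] and feeds Fatou's lemma; the second tends to [0]. Its constant
    covers the Lipschitz error at mesh [2 / (N + 1)] inside the grid and the tail error outside. *)
Lemma step_approximation (R : realType) (D : set R) (N : nat) :
  (forall a b, a < b -> exists x, a < x < b /\ D x) ->
  exists (x : nat -> R) K, [/\ forall i, D (x i), forall i, x i <= x i.+1,
    forall n u, `|step_fun x K (fun v => v ^+ n) u| <=
      9 ^+ n * (1 + u ^+ 2) ^+ n &
    forall n u, `|u ^+ n - step_fun x K (fun v => v ^+ n) u| <=
      (2 * n%:R * 9 ^+ n + 2) / (N%:R + 1) * (1 + u ^+ 2) ^+ n.+1].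
Proof.
move=> /(@grid_dense _ _ N)[x [K [Dx xS x0 xK]]].
have xle i : x i <= x i.+1 by have /andP[] := xS i.
have N1 : 0 < N%:R + 1 :> R by rewrite ltr_pwDr.
have N0 : 0 <= N%:R :> R by [].
have d2 : 2 / (N%:R + 1) <= 2 :> R by rewrite ler_pdivrMr// ler_peMr// lerDr.
have close i u : x i < u <= x i.+1 -> `|u - x i.+1| <= 2 / (N%:R + 1).
  move=> /andP[xu ux]; have /andP[_ xSi] := xS i.
  by rewrite ler_norml; apply/andP; split; lra.
have w0 u k : 0 <= (1 + u ^+ 2) ^+ k :> R.
  by rewrite exprn_ge0// addr_ge0// sqr_ge0.
exists x, K; split=> // n u;
    have [[i iu ->]|[ux ->]] := step_funP K (fun v => v ^+ n) u xle.
- exact/pow_le_weight/(le_trans (close _ _ iu)).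
- by rewrite normr0 mulr_ge0.
- have ci := close _ _ iu.
  rewrite (le_trans (pow_lipschitz n (le_trans ci d2)))//.
  have wS : (1 + u ^+ 2) ^+ n <= (1 + u ^+ 2) ^+ n.+1.
    by rewrite [leRHS]exprS ler_peMl// lerDl sqr_ge0.
  have t1 : n%:R * `|u - x i.+1| * (9 ^+ n * (1 + u ^+ 2) ^+ n) <=
      n%:R * (2 / (N%:R + 1)) * (9 ^+ n * (1 + u ^+ 2) ^+ n.+1).
    by apply: ler_pM; rewrite ?mulr_ge0// ler_wpM2l.
  rewrite (le_trans t1)// -subr_ge0.
  have -> : (2 * n%:R * 9 ^+ n + 2) / (N%:R + 1) * (1 + u ^+ 2) ^+ n.+1 -
      n%:R * (2 / (N%:R + 1)) * (9 ^+ n * (1 + u ^+ 2) ^+ n.+1) =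
      2 / (N%:R + 1) * (1 + u ^+ 2) ^+ n.+1 by ring.
  by rewrite mulr_ge0// divr_ge0// ltW.
- have Nu : N%:R <= `|u|.
    case: ux => [ux|ux]; last by rewrite (le_trans _ (ler_norm u))//; lra.
    by have := ler_norm (- u); rewrite normrN; lra.
  rewrite subr0 (le_trans (pow_tail n N0 Nu))//.
  by rewrite ler_wpM2r// ler_pM2r ?invr_gt0// lerDr mulr_ge0// mulr_ge0.
Qed.

(** * Integrals against Lebesgue-Stieltjes measures *)

Lemma integral_horner (R : realType) (rho : probability (measurableTypeR R) R)
    (m : nat -> R) (P : {poly R}) : has_moments rho m ->
  rho.-integrable [set: measurableTypeR R] (fun u => (P.[u])%:E) /\
  (\int[rho]_u (P.[u])%:E = (moment_functional m P)%:E)%E.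
Proof.
move=> mom.
have PE : (fun u : measurableTypeR R => (P.[u])%:E) =
    (fun u : measurableTypeR R =>
      (\sum_(i < size P) (P`_i)%:E * (u ^+ i)%:E)%E).
  by apply/funext => u; rewrite horner_coef -sumEFin; apply: eq_bigr.
have int i : rho.-integrable [set: measurableTypeR R]
    (fun u => (P`_i)%:E * (u ^+ i)%:E)%E.
  by apply: integrableZl => //; exact: (mom i).1.
rewrite PE; split; first by apply: integrable_sum => // i _; exact: int.
rewrite (@integral_sum _ _ _ rho setT measurableT _
  (fun i : 'I_(size P) => fun u : measurableTypeR R =>
    (P`_i)%:E * (u ^+ i)%:E)%E); last first.
  by move=> i; exact: int.
rewrite -sumEFin; apply: eq_bigr => i _.
by rewrite integralZl//; [rewrite (mom i).2|exact: (mom i).1].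
Qed.

Lemma integral_step_fun (R : realType) (F : cumulativeBounded (0 : R) (1 : R))
    (x : nat -> R) K (phi : R -> R) : (forall i, x i <= x i.+1) ->
  (lebesgue_stieltjes_measure F).-integrable [set: measurableTypeR R]
    (fun u => (step_fun x K phi u)%:E) /\
  (\int[lebesgue_stieltjes_measure F]_u (step_fun x K phi u)%:E =
   (\sum_(i < K) phi (x i.+1) * (F (x i.+1) - F (x i)))%:E)%E.
Proof.
move=> xS; set rho := lebesgue_stieltjes_measure F.
have PE : (fun u : measurableTypeR R => (step_fun x K phi u)%:E) =
    (fun u : measurableTypeR R =>
      (\sum_(i < K) (phi (x i.+1))%:E * (\1_(`]x i, x i.+1]%classic) u)%:E)%E).
  by apply/funext => u; rewrite -sumEFin; apply: eq_bigr.
have int1 i : rho.-integrable [set: measurableTypeR R]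
    (fun u => (\1_(`]x i, x i.+1]%classic) u)%:E).
  by apply: integrable_indic; exact: measurable_itv.
have int i : rho.-integrable [set: measurableTypeR R]
    (fun u => (phi (x i.+1))%:E * (\1_(`]x i, x i.+1]%classic) u)%:E)%E.
  exact: integrableZl.
rewrite PE; split; first by apply: integrable_sum => // i _; exact: int.
rewrite (@integral_sum _ _ _ rho setT measurableT _
  (fun i : 'I_K => fun u : measurableTypeR R =>
    (phi (x i.+1))%:E * (\1_(`]x i, x i.+1]%classic) u)%:E)%E); last first.
  by move=> i; exact: int.
rewrite -sumEFin; apply: eq_bigr => i _.
rewrite integralZl// integral_indic//.
rewrite setIT EFinM; congr (_ * _)%E; exact: lebesgue_stieltjes_ocitv.
Qed.

Lemma measurable_pow (R : realType) n :
  measurable_fun [set: measurableTypeR R]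
    (fun u : measurableTypeR R => (u ^+ n)%:E).
Proof. by apply/measurable_EFinP; exact: (@exprn_measurable R setT n). Qed.

(** Even powers are non-negative, so a finite integral makes them integrable;
    [|u ^+ n| <= 1 + u ^+ (2 * n)] handles the rest. *)
Lemma pow_integrable_even (R : realType)
    (rho : probability (measurableTypeR R) R) :
  (forall k, \int[rho]_u (u ^+ (2 * k))%:E < +oo)%E ->
  forall n, rho.-integrable [set: measurableTypeR R] (fun u => (u ^+ n)%:E).
Proof.
move=> even n.
have int2 : rho.-integrable [set: measurableTypeR R]
    (fun u => (u ^+ (2 * n))%:E).
  apply/integrableP; split; first exact: measurable_pow.
  under eq_integral.
    move=> u _; rewrite abse_EFin ger0_norm; last first.
      by rewrite exprM exprn_ge0// sqr_ge0.
    over.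
  exact: even.
have int1 : rho.-integrable [set: measurableTypeR R]
    (fun u => (1 + u ^+ (2 * n))%:E).
  have int0 := finite_measure_integrable_cst rho 1 measurableT.
  by have := integrableD measurableT int0 int2; exact.
apply: le_integrable int1 => //; first exact: measurable_pow.
move=> u _; rewrite !abse_EFin lee_fin.
rewrite [leRHS]ger0_norm; last by rewrite addr_ge0// exprM exprn_ge0// sqr_ge0.
rewrite mulnC exprM; set v := u ^+ n.
by rewrite ler_norml; apply/andP; split; nra.
Qed.

(** The pointwise limit [g] is the limit inferior, so Fatou's lemma carries the uniform bound
    over. *)
Lemma fatou_bound d (T : measurableType d) (R : realType)
    (mu : {measure set T -> \bar R}) (f : nat -> T -> R) (g : T -> R) (C : R) :
  (forall n, measurable_fun [set: T] (EFin \o f n)) ->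
  (forall n x, 0 <= f n x) -> (forall x, f n x @[n --> \oo] --> g x) ->
  (forall n, \int[mu]_x (f n x)%:E <= C%:E)%E ->
  (\int[mu]_x (g x)%:E <= C%:E)%E.
Proof.
move=> mf f0 fg fC.
have -> : (\int[mu]_x (g x)%:E = \int[mu]_x limn_einf (fun n => (f n x)%:E))%E.
  apply: eq_integral => x _.
  have /cvg_limn_einf_sup[-> _//] : (f n x)%:E @[n --> \oo] --> (g x)%:E.
  by apply: cvg_EFin; [exact: nearW|exact: fg].
apply: le_trans (fatou mu measurableT mf _) _.
  by move=> n x _; rewrite lee_fin.
rewrite limn_einf_lim; apply: lime_le; first exact: is_cvg_einfs.
apply: nearW => n; apply: le_trans (fC n).
by apply: ge_ereal_inf; exists (\int[mu]_x (f n x)%:E)%E => //; exists n => /=.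
Qed.

Lemma integral_close d (T : measurableType d) (R : realType)
    (mu : {measure set T -> \bar R}) (f g q : T -> R) (a b c : R) :
  mu.-integrable [set: T] (EFin \o f) -> mu.-integrable [set: T] (EFin \o g) ->
  mu.-integrable [set: T] (EFin \o q) -> (forall u, `|f u - g u| <= q u) ->
  (\int[mu]_u (f u)%:E = a%:E)%E -> (\int[mu]_u (g u)%:E = b%:E)%E ->
  (\int[mu]_u (q u)%:E = c%:E)%E -> `|a - b| <= c.
Proof.
move=> intf intg intq fgq fa gb qc.
have half (f' g' : T -> R) (a' b' : R) :
    mu.-integrable [set: T] (EFin \o f') -> mu.-integrable [set: T] (EFin \o g') ->
    (forall u, `|f' u - g' u| <= q u) ->
    (\int[mu]_u (f' u)%:E = a'%:E)%E -> (\int[mu]_u (g' u)%:E = b'%:E)%E ->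
    a' <= b' + c.
  move=> intf' intg' fgq' fa' gb'; rewrite -lee_fin EFinD -fa' -gb' -qc.
  rewrite -[leRHS](integralD measurableT intg' intq).
  apply: le_integral => //; first exact: integrableD.
  by move=> u _; rewrite lee_fin/= -lerBlDl (le_trans (ler_norm _)).
rewrite ler_distl lerBlDr; apply/andP; split.
  by apply: half intg intf _ gb fa => u; rewrite distrC.
exact: half intf intg fgq fa gb.
Qed.

Lemma le_divS_cvg (R : realType) (a : nat -> R) (l c : R) :
  (forall n, `|l - a n| <= c / (n%:R + 1)) -> a n @[n --> \oo] --> l.
Proof.
move=> ac; apply/cvgrPdist_le => e e0; near=> n.
rewrite (le_trans (ac n))// ler_pdivrMr ?ltr_pwDr// mulrC -ler_pdivrMr//.
have : c / e <= n%:R by near: n; exact: nbhs_infty_ger.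
by move=> cn; rewrite (le_trans cn)// lerDl.
Unshelve. all: by end_near. Qed.

(** * Representation by a measure *)

Lemma indic_itv_ocE (R : realType) (a b : R) : a <= b ->
  \1_(`]a, b]%classic) = \1_(`]-oo, b]%classic) - \1_(`]-oo, a]%classic) :> (R -> R).
Proof.
move=> ab; apply/funext => u.
rewrite -[RHS]/(\1_(`]-oo, b]%classic) u - \1_(`]-oo, a]%classic) u).
rewrite !indicE !mem_setE !in_itv/=; have [ua|ua] := leP u a; last by rewrite subr0.
by rewrite (le_trans ua ab) subrr.
Qed.

Section extension_to_measure.
Context {R : realType} (m : nat -> R) (S0 : set R) (L : (R -> R) -> R).
Let E := poly_bounded S0.
Let mu := moment_functional m.
Hypothesis LD : {in E &, {morph L : f g / f + g}}.
Hypothesis LZ : forall t, {in E, {morph L : f / t *: f >-> t * f}}.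
Hypothesis L_ge0 : forall f, E f -> (forall u, S0 u -> 0 <= f u) -> 0 <= L f.
Hypothesis L_horner : forall P : {poly R}, L (horner P) = mu P.

Let sE : subspace E := poly_bounded_subspace S0.

Let LB f g : E f -> E g -> L (f - g) = L f - L g.
Proof.
move=> Ef Eg; rewrite -(scaleN1r g) LD ?inE//; last exact: subspaceZ.
by rewrite LZ ?inE// mulN1r.
Qed.

Let L_le f g : E f -> E g -> (forall u, S0 u -> f u <= g u) -> L f <= L g.
Proof.
move=> Ef Eg fg; rewrite -subr_ge0 -LB//; apply: L_ge0.
  by apply: (subspaceD sE) => //; exact: (subspaceN sE).
by move=> u Su; rewrite -[X in 0 <= X]/(g u - f u) subr_ge0 fg.
Qed.

(** Comparison with [0] on [S0] in both directions. This is what will confine the support to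
    [S0]. *)
Let L_eq0 f : (forall u, S0 u -> f u = 0) -> L f = 0.
Proof.
move=> f0; have Ef : E f by exists 0 => u Su; rewrite f0// normr0 hornerE.
have L0 : L 0 = 0.
  have := LB (subspace0 sE) (subspace0 sE).
  by rewrite subr0 subrr.
have E0 := subspace0 sE; rewrite -L0; apply/eqP; rewrite eq_le.
by rewrite !L_le// => u Su; rewrite f0.
Qed.

Let L_sum K (c : nat -> R) (f : nat -> R -> R) : (forall i, E (f i)) ->
  let s := fun u => \sum_(i < K) c i * f i u in
  E s /\ L s = \sum_(i < K) c i * L (f i).
Proof.
move=> Ef.
have -> /= : (fun u => \sum_(i < K) c i * f i u) = \sum_(i < K) c i *: f i.
  by apply/funext => u; rewrite fct_sumE.
elim: K => [|K [IH1 IH2]].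
  by rewrite !big_ord0 L_eq0//; split=> //; exact: (subspace0 sE).
have EK : E (c K *: f K) by apply: (subspaceZ sE).
rewrite !big_ord_recr/=; split; first exact: (subspaceD sE).
by rewrite LD ?inE// IH2 LZ// inE.
Qed.

Let E_indic (A : set R) : E (\1_A).
Proof.
exists 1 => u _; rewrite hornerE indicE.
by case: (u \in A); rewrite ?normr0 ?normr1.
Qed.

(** The candidate distribution function. [L] is not known to be countably additive, so [G] may fail
    to be right-continuous. *)
Let G (x : R) : R := L \1_(`]-oo, x]%classic).

Let G_itv a b : a <= b -> L \1_(`]a, b]%classic) = G b - G a.
Proof. by move=> ab; rewrite indic_itv_ocE// LB. Qed.

Let ndG : nondecreasing G.
Proof.
move=> a b ab; rewrite -subr_ge0 -G_itv//.
by apply: L_ge0 => // u _; rewrite indicE.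
Qed.

Let L1 : L (fun=> 1) = m 0%N.
Proof.
rewrite -(moment_functionalXn m) -/mu -L_horner; congr L.
by apply/funext => u; rewrite !hornerE.
Qed.

(** Chebyshev's inequality for [L]: the indicators of [u <= - x] and of [u > x] are at most
    [u ^+ 2 / x ^+ 2]. *)
Let G_tail x : 0 < x -> G (- x) <= m 2%N / x ^+ 2 /\ m 0%N - G x <= m 2%N / x ^+ 2.
Proof.
move=> x0; have E1 : E (fun=> 1) by exists 1 => u _; rewrite hornerE normr1.
have x20 : 0 < x ^+ 2 by rewrite exprn_gt0.
have -> : m 2%N / x ^+ 2 = L (horner ((x ^+ 2)^-1 *: 'X^2)).
  by rewrite L_horner /mu moment_functionalZ moment_functionalXn mulrC.
have EP := poly_bounded_horner S0 ((x ^+ 2)^-1 *: 'X^2).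
rewrite -L1 -LB//; split; apply: L_le => //.
- move=> u _; rewrite hornerZ hornerXn mulrC ler_pdivlMr// indicE mem_setE in_itv/=.
  by case: (leP u (- x)) => ux; rewrite ?mul1r ?mul0r ?sqr_ge0//; nra.
- by apply: (subspaceD sE) => //; apply: (subspaceN sE).
- move=> u _; rewrite -[leLHS]/(1 - \1_(`]-oo, x]%classic) u).
  rewrite hornerZ hornerXn mulrC ler_pdivlMr// indicE mem_setE in_itv/=.
  by case: (leP u x) => ux; rewrite ?subrr ?subr0 ?mul1r ?mul0r ?sqr_ge0//; nra.
Qed.

Hypothesis m0 : m 0%N = 1.
Hypothesis S0_closed : closed S0.

Let G_ge0 x : 0 <= G x.
Proof. by apply: L_ge0 => // u _; rewrite indicE. Qed.

Let G_le1 x : G x <= 1.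
Proof.
rewrite -m0 -L1; apply: L_le => //.
by exists 1 => u _; rewrite hornerE normr1.
Qed.

Let tail_small e : 0 < e -> exists2 x, 0 < x & m 2%N / x ^+ 2 <= e.
Proof.
move=> e0; have m2 : 0 <= m 2%N.
  rewrite -(moment_functionalXn m) -/mu -L_horner; apply: L_ge0.
    exact: poly_bounded_horner.
  by move=> u _; rewrite hornerE sqr_ge0.
(* With [d = m 2 / e] the claim reduces to [d <= (d + 1) ^+ 2]. *)
exists (m 2%N / e + 1); first by rewrite ltr_wpDl// divr_ge0// ltW.
have d0 : 0 <= m 2%N / e by rewrite divr_ge0// ltW.
rewrite ler_pdivrMr; last by rewrite exprn_gt0// ltr_wpDl.
have -> : m 2%N = m 2%N / e * e by rewrite divfK// gt_eqF.
set d := m 2%N / e in d0 *; rewrite -/d.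
by rewrite (_ : d * e / e = d) ?mulfK ?gt_eqF//; nra.
Qed.

Let G_Ny : G @ -oo --> (0 : R).
Proof.
apply/cvgrPdist_le => e e0; have [x x0 xe] := tail_small e0.
exists (- x); split; first exact: num_real.
move=> y yx; rewrite sub0r normrN ger0_norm//.
by rewrite (le_trans _ xe)// (le_trans (ndG (ltW yx)))// (G_tail x0).1.
Qed.

Let G_y : G @ +oo --> (1 : R).
Proof.
apply/cvgrPdist_le => e e0; have [x x0 xe] := tail_small e0.
exists x; split; first exact: num_real.
move=> y yx; rewrite ger0_norm ?subr_ge0//.
rewrite (le_trans _ xe)// (le_trans _ (G_tail x0).2)// m0 lerD2l lerN2.
exact/ndG/ltW.
Qed.

Let abs_L f g : E f -> E g -> (forall u, S0 u -> `|f u| <= g u) -> `|L f| <= L g.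
Proof.
move=> Ef Eg fg; rewrite ler_norml.
have -> : - L g = L (- g) by rewrite -(scaleN1r g) LZ ?inE// mulN1r.
apply/andP; split; apply: L_le => //; first exact: (subspaceN sE).
  by move=> u /fg; rewrite ler_norml => /andP[].
by move=> u /fg; rewrite ler_norml => /andP[].
Qed.

(** * Support and moments of the regularized distribution function *)

Section regularized.
Variable F : cumulativeBounded (0 : R) (1 : R).
Hypothesis GF : forall x, G x <= F x.
Hypothesis FG : forall x y, x < y -> F x <= G y.
Let rho := lebesgue_stieltjes_measure F.

Lemma regularized_supp : supp F `<=` S0.
Proof.
move=> x suppx; apply: contrapT => nS0x.
have /nbhs_ballP[r /= r0 xr] : nbhs x (~` S0).
  by apply: open_nbhs_nbhs; split=> //; exact: closed_openC.
have nS0 u : `|x - u| < r -> ~ S0 u by move=> xu; exact: (xr u xu).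
(* [L] kills the indicator of this interval, which misses [S0]. The extra [r / 4] provides the
   strict inequality behind [F (x + r / 2) <= G (x + r / 2 + r / 4)]. *)
have Geq : G (x + r / 2 + r / 4) = G (x - r / 2).
  apply/eqP; rewrite -subr_eq0 -G_itv; last by lra.
  rewrite L_eq0// => u Su; rewrite indicE memNset//= in_itv/= => /andP[? ?].
  by apply: nS0 Su; rewrite ltr_norml; apply/andP; split; lra.
have Feq : F (x + r / 2) = F (x - r / 2).
  apply/eqP; rewrite eq_le; apply/andP; split; last first.
    by apply: cumulative_is_nondecreasing; lra.
  by apply: (le_trans _ (GF _)); rewrite -Geq FG//; lra.
set a := x - r / 2 in Feq; set b := x + r / 2 in Feq.
have ab : a <= b by rewrite /a /b; lra.
have : (0 < rho `]a, b[%classic)%E.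
  apply: suppx; first exact: interval_open.
  by rewrite /= in_itv/= /a /b; apply/andP; split; lra.
apply/negP; rewrite -leNgt; apply: (@le_trans _ _ (rho `]a, b]%classic)).
  by apply: le_measure; rewrite ?inE//; exact: subset_itv_oo_oc.
by rewrite /rho lebesgue_stieltjes_ocitv// lee_fin subr_le0 [leLHS]Feq.
Qed.

(** At nodes where [F] and [G] agree, [L] and [rho] give each cell the same value. *)
Let L_step (x : nat -> R) K phi : (forall i, G (x i) = F (x i)) ->
  (forall i, x i <= x i.+1) -> E (step_fun x K phi) /\
  (\int[rho]_u (step_fun x K phi u)%:E = (L (step_fun x K phi))%:E)%E.
Proof.
move=> xD xS.
have [Es Ls] := @L_sum K (fun i => phi (x i.+1))
  (fun i => \1_(`]x i, x i.+1]%classic)) (fun=> E_indic _).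
split; first exact: Es.
rewrite (integral_step_fun F K phi xS).2 -[RHS]/((L (fun u => _))%:E) Ls.
by congr EFin; apply: eq_bigr => i _; rewrite G_itv// !xD.
Qed.

(** The weight is a polynomial, so [L] and integration against [rho] both evaluate it through
    moments. *)
Let w n : {poly R} := (1 + 'X^2) ^+ n.

Let wE n u : (w n).[u] = (1 + u ^+ 2) ^+ n.
Proof. by rewrite /w horner_exp !hornerE. Qed.

(** The pair holds the nodes and the number of cells; one grid serves all exponents [n]. *)
Let approximates N (x : (nat -> R) * nat) :=
  let T n := step_fun x.1 x.2 (fun v => v ^+ n) in
  [/\ forall n, E (T n) /\ (\int[rho]_u (T n u)%:E = (L (T n))%:E)%E,
      forall n, rho.-integrable [set: measurableTypeR R] (EFin \o T n),
      forall n u, `|T n u| <= (9 ^+ n *: w n).[u] &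
      forall n u, `|u ^+ n - T n u| <=
        (((2 * n%:R * 9 ^+ n + 2) / (N%:R + 1)) *: w n.+1).[u] ].

Let approx : exists x, forall N, approximates N (x N).
Proof.
have dD a b : a < b -> exists x, a < x < b /\ G x = F x.
  by move=> /(regularization_eq_dense GF FG)[x [axb Fx]]; exists x.
suff /choice[x xP] : forall N, exists x, approximates N x by exists x.
move=> N; have [x [K [xD xS xb xa]]] := step_approximation N dD.
exists (x, K); split => /= n.
- exact: L_step.
- exact: (integral_step_fun F K _ xS).1.
- by move=> u; rewrite hornerZ wE.
- by move=> u; rewrite hornerZ wE.
Qed.

(** For even exponents the step functions are non-negative, and their integrals equal values of [L]
    bounded by [mu (9 ^+ n2 *: w n2)] for every [N]; Fatou's lemma concludes. *)
Let integrable_pow n : rho.-integrable [set: measurableTypeR R]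
  (fun u => (u ^+ n)%:E).
Proof.
apply: pow_integrable_even => k; have [x xP] := approx.
set n2 := (2 * k)%N; pose T N := step_fun (x N).1 (x N).2 (fun v => v ^+ n2).
apply: le_lt_trans (ltry (mu (9 ^+ n2 *: w n2))).
apply: (@fatou_bound _ _ _ rho T).
- by move=> N; have [_ /(_ n2)/measurable_int] := xP N.
- move=> N u; apply: sumr_ge0 => i _; rewrite mulr_ge0//.
  by rewrite /n2 exprM exprn_ge0// sqr_ge0.
- move=> u; apply: (@le_divS_cvg _ _ _ ((2 * n2%:R * 9 ^+ n2 + 2) * (w n2.+1).[u])).
  by move=> N; have [_ _ _ /(_ n2 u)] := xP N; rewrite hornerZ mulrAC.
- move=> N; have [/(_ n2)[ET ->] _ Tb _] := xP N.
  rewrite lee_fin -L_horner; apply: L_le => //; first exact: poly_bounded_horner.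
  by move=> u _; rewrite (le_trans (ler_norm _)).
Qed.

(** The values [L (T N)] tend to [m n] by the error bound under [L], and to the actual moment by the
    same bound under [rho]. *)
Lemma regularized_moments : has_moments rho m.
Proof.
(* The actual moments of [rho]: they make the integral of the error weight a fixed finite constant
   before [m' = m] is known. *)
pose m' n := fine (\int[rho]_u (u ^+ n)%:E)%E.
have mom' : has_moments rho m'.
  move=> n; split; first exact: integrable_pow.
  by rewrite fineK//; apply: integrable_fin_num => //; exact: integrable_pow.
move=> n; split; first exact: integrable_pow.
rewrite (mom' n).2; congr EFin; have [x xP] := approx.
pose T N := step_fun (x N).1 (x N).2 (fun v => v ^+ n).
pose c : R := 2 * n%:R * 9 ^+ n + 2.
have EX : E (fun u => u ^+ n).
  have := poly_bounded_horner S0 'X^n; congr E.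
  by apply/funext => u; rewrite hornerXn.
have LX : L (fun u => u ^+ n) = m n.
  rewrite -(moment_functionalXn m) -/mu -L_horner; congr L.
  by apply/funext => u; rewrite hornerXn.
have TL : L (T N) @[N --> \oo] --> m n.
  apply: (@le_divS_cvg _ _ _ (c * mu (w n.+1))) => N.
  have [/(_ n)[ET _] _ _ /(_ n) Ta] := xP N.
  rewrite mulrAC -moment_functionalZ -/mu -L_horner -LX -LB//.
  apply: abs_L.
  - by apply: (subspaceD sE) => //; exact: (subspaceN sE).
  - exact: poly_bounded_horner.
  - by move=> u _; exact: Ta.
have TI : L (T N) @[N --> \oo] --> m' n.
  apply: (@le_divS_cvg _ _ _ (c * moment_functional m' (w n.+1))) => N.
  have [/(_ n)[_ intT] iT _ /(_ n) Ta] := xP N.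
  have [iw Iw] := integral_horner ((c / (N%:R + 1)) *: w n.+1) mom'.
  rewrite mulrAC -moment_functionalZ.
  exact: (integral_close (integrable_pow n) (iT n) iw Ta (mom' n).2 intT Iw).
exact: (cvg_unique _ TI TL).
Qed.

End regularized.

Lemma extension_represented : exists F : cumulativeBounded (0 : R) (1 : R),
  supp F `<=` S0 /\ has_moments (lebesgue_stieltjes_measure F) m.
Proof.
have [F [GF FG]] := right_regularization ndG G_Ny G_y.
exists F; split; first exact: regularized_supp GF FG.
exact: regularized_moments GF FG.
Qed.

End extension_to_measure.

(** * Necessity: non-negativity from a representing measure *)

Lemma negligible_setC_supp (R : realType) (F : cumulative R R) :
  (lebesgue_stieltjes_measure F).-negligible (~` supp F).
Proof.
set lsF := lebesgue_stieltjes_measure F.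
pose V (ab : rat * rat) : set R := `]ratr ab.1, ratr ab.2[%classic.
(* Enumeration of the null rational intervals; codes of no pair and intervals of positive measure
   contribute the empty set. *)
pose J n := if unpickle n is Some ab then
  (if lsF (V ab) == 0%E then V ab else set0) else set0.
have negJ : lsF.-negligible (\bigcup_n J n).
  apply: negligible_bigcup => n; rewrite /J; case: unpickle => [ab|]; last first.
    exact: negligible_set0.
  case: ifP => [/eqP ab0|_]; last exact: negligible_set0.
  by exists (V ab); split=> //; exact: measurable_itv.
apply: negligibleS negJ.
move=> x nx.
have [U [oU Ux U0]] : exists U : set R, [/\ open U, U x & lsF U = 0%E].
  apply: contrapT => nU; apply: nx => U oU Ux.
  rewrite lt_neqAle measure_ge0 andbT; apply/eqP => U0.
  by apply: nU; exists U; split.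
have /nbhs_ballP[r /= r0 xr] : nbhs x U by exact: open_nbhs_nbhs.
have xl : x - r < x by rewrite ltrBlDr ltrDl.
have xu : x < x + r by rewrite ltrDl.
have [a] := rat_in_itvoo xl; have [b] := rat_in_itvoo xu.
rewrite !in_itv/= => /andP[xb br] /andP[ra ax].
have VU : V (a, b) `<=` U.
  move=> u; rewrite /V/= in_itv/= => /andP[au ub]; apply: xr => /=.
  by rewrite /ball/= ltr_norml; apply/andP; split; lra.
apply: (bigcup_sup (i := pickle (a, b)) I); rewrite /J pickleK.
rewrite (_ : lsF (V (a, b)) = 0%E) ?eqxx /V/= ?in_itv/= ?ax//.
apply/eqP; rewrite eq_le measure_ge0 andbT -U0.
by apply: le_measure; rewrite ?inE//; exact: open_measurable.
Qed.

(** [P] can be negative only off [S0], hence off the support, a null set; so [P] equals its absolute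
    value almost everywhere. *)
Lemma represented_nonnegative (R : realType) (m : nat -> R) (S0 : set R)
    (rho : probability (measurableTypeR R) R) (F : cumulative R R) :
  associated rho F -> supp F `<=` S0 -> has_moments rho m ->
  nonnegative_on S0 (moment_functional m).
Proof.
move=> rhoF FS mom P P0; rewrite -lee_fin.
have [intP <-] := integral_horner P mom.
have mP := measurable_int _ intP.
have -> : (\int[rho]_u (P.[u])%:E = \int[rho]_u `|(P.[u])%:E|)%E.
  apply: ae_eq_integral => //; first exact: measurableT_comp.
  have [N [mN N0 sN]] := negligible_setC_supp F.
  exists N; split; [exact: mN|exact: etrans (rhoF N mN) N0|].
  move=> u nu; apply: sN => su; apply: nu => _.
  by rewrite gee0_abs// lee_fin P0//; exact: FS.
by apply: integral_ge0 => u _; exact: abse_ge0.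
Qed.

Theorem theorem4 (R : realType) (m : nat -> R) (m0 : m 0%N = 1)
    (S0 : set R) (S0_neq0 : S0 !=set0) (S0_closed : closed S0) :
  (exists (rho : probability (measurableTypeR R) R) (F : cumulative R R),
     [/\ associated rho F, supp F `<=` S0 & has_moments rho m])
  <-> nonnegative_on S0 (moment_functional m).
Proof.
split=> [[rho [F [rhoF FS mom]]]|/riesz_extension[L [LD LZ L0 Lmu]]].
  exact: represented_nonnegative rhoF FS mom.
have [F [FS mom]] := extension_represented LD LZ L0 Lmu m0 S0_closed.
(* The limits [0] and [1] of [F] make its measure a probability. *)
by exists (lebesgue_stieltjes_measure F), F.
Qed.
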